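(* Let $\mathcal I$ be a free ideal on $\mathbb N_0$ and let $\mathbf u=(u_n)_{n\in\mathbb N_0}$ be a $T^{\mathcal I}$-sequence in an abelian group $G$. Then the family $(\mathbf u_{(I_n)})_{(I_n)\in\mathcal I^{\mathbb N}_{\uparrow}}$ forms a neighborhood base at $0$ for the finest (not necessarily Hausdorff) group topology on $G$ in which $\mathbf u$ $\mathcal I$-converges to $0$.
   Context: $\mathbb N=\{1,2,\dots\}$, $\mathbb N_0=\{0\}\cup\mathbb N$. An ideal $\mathcal I$ on $\mathbb N_0$ is a nonempty family of subsets of $\mathbb N_0$ closed under taking subsets and finite unions; it is free if it contains all finite subsets of $\mathbb N_0$. A sequence $(x_n)$ in a topological space $\mathcal I$-converges to $x$ if $\{n\in\mathbb N_0: x_n\notin U\}\in\mathcal I$ for every neighborhood $U$ of $x$. A sequence $\mathbf u$ in an abelian group $G$ is a $T^{\mathcal I}$-sequence if there is a Hausdorff group topology on $G$ in which $\mathbf u$ $\mathcal I$-converges to $0$. The finest group topology on $G$ in which $\mathbf u$ $\mathcal I$-converges to $0$ always exists: it is the supremum of all group topologies with this property. For $I\in\mathcal I$ let $\mathbf u_I=\{0\}\cup\{\pm u_n: n\in\mathbb N_0\setminus I\}$. For a sequence $(I_n)_{n\in\mathbb N}$ in $\mathcal I$ let $\mathbf u_{(I_n)}=\bigcup_{N\in\mathbb N}(\mathbf u_{I_1}+\dots+\mathbf u_{I_N})$. $\mathcal I^{\mathbb N}_{\uparrow}$ denotes the family of all increasing sequences $(I_n)_{n\in\mathbb N}$ in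 $\mathcal I$ (i.e., $I_n\subseteq I_{n+1}$ for all $n$). *)

(* Defs.v *)
From mathcomp Require Import all_boot all_order all_algebra.
From mathcomp Require Import all_classical topology.

Set Implicit Arguments.
Unset Strict Implicit.
Unset Printing Implicit Defensive.

Import GRing.Theory.

Local Open Scope classical_set_scope.
Local Open Scope ring_scope.

Definition is_ideal (I : set (set nat)) : Prop :=
  [/\ I !=set0,
      (forall A B : set nat, B `<=` A -> I A -> I B) &
      (forall A B : set nat, I A -> I B -> I (A `|` B))].

Definition is_free_ideal (I : set (set nat)) : Prop :=
  is_ideal I /\ (forall A : set nat, finite_set A -> I A).

Definition ideal_cvg (T : topologicalType) (I : set (set nat))
    (x : nat -> T) (l : T) : Prop :=
  forall U : set T, nbhs l U -> I [set n | ~ U (x n)].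

(* Several topologies live on the same group G. As in [sup_topology], a topology
   on G is a term [tau : Topological G], and G equipped with tau is the space
   [Topological.Pack tau], whose carrier is G by conversion. *)
Notation top_space tau := (Topological.Pack tau).

Definition group_topology (G : zmodType) (tau : Topological G) : Prop :=
  continuous (fun z : top_space tau * top_space tau => (z.1 : G) + z.2 : top_space tau) /\
  continuous (fun z : top_space tau => - (z : G) : top_space tau).

Definition ideal_null (G : zmodType) (I : set (set nat)) (u : nat -> G)
    (tau : Topological G) : Prop :=
  @ideal_cvg (top_space tau) I u (0 : G).

Definition T_ideal_sequence (G : zmodType) (I : set (set nat))
    (u : nat -> G) : Prop :=
  exists tau : Topological G,
    [/\ group_topology tau, hausdorff_space (top_space tau) & ideal_null I u tau].

Definition finest_group_topology (G : zmodType) (I : set (set nat))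
    (u : nat -> G) : Topological G :=
  Topological.class (sup_topology
    (fun t : {tau : Topological G | group_topology tau /\ ideal_null I u tau} =>
       sval t)).

Definition finer (T : Type) (tau sigma : Topological T) : Prop :=
  @open (top_space sigma) `<=` @open (top_space tau).

Definition nbhs_base (T : topologicalType) (x : T) (B : set (set T)) : Prop :=
  B `<=` nbhs x /\
  (forall U : set T, nbhs x U -> exists2 V : set T, B V & V `<=` U).

Definition sym_tail (G : zmodType) (u : nat -> G) (A : set nat) : set G :=
  [set 0] `|` [set u n | n in ~` A] `|` [set - u n | n in ~` A].

(* Sequences indexed by {1, 2, ...} are represented with indices shifted by one:
   [J n] stands for I_(n+1), and the N-th member of the union is
   the setwise sum u_(I_1) + ... + u_(I_(N+1)). *)
Definition tail_sums (G : zmodType) (u : nat -> G) (J : nat -> set nat) :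
    set G :=
  \bigcup_N [set \sum_(i < N.+1) x i | x in
    [set x : 'I_N.+1 -> G | forall i : 'I_N.+1, sym_tail u (J i) (x i)]].

Definition increasing_seq (I : set (set nat)) : set (nat -> set nat) :=
  [set J | (forall n, I (J n)) /\ (forall n, J n `<=` J n.+1)].

Section finest_group_topology_theory.
Variables (G : zmodType) (I : set (set nat)) (u : nat -> G).

Let finest := finest_group_topology I u.

Lemma finest_nbhs (tau : Topological G) (x : G) :
  group_topology tau -> ideal_null I u tau ->
  @nbhs _ (top_space tau) x `<=` @nbhs _ (top_space finest) x.
Proof.
move=> gt It.
pose Tc := fun t : {tau : Topological G | group_topology tau /\
  ideal_null I u tau} => sval t.
have /cvg_sup := @cvg_refl _ (@nbhs _ (sup_topology Tc) x).
by move=> /(_ (exist _ tau (conj gt It))).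
Qed.

Lemma finest_finer (tau : Topological G) :
  group_topology tau -> ideal_null I u tau -> finer finest tau.
Proof.
move=> gt It U; rewrite !openE => oU x Ux.
exact: (finest_nbhs gt It) (oU x Ux).
Qed.

Lemma finest_is_group_topology : group_topology finest.
Proof.
split=> [[x y]|x].
- apply/cvg_sup => -[tau /= [[addc oppc] It]] U Uxy.
  have [[V W] /= [Vx Wy] VWU] := addc (x, y) U Uxy.
  have sub := fun z => @finest_nbhs tau z (conj addc oppc) It.
  by exists (V, W) => //=; split; exact: sub.
- have FF : Filter ((fun z : top_space finest => - (z : G)) @ (x : top_space finest)).
    apply: fmap_filter; exact: (@nbhs_filter (top_space finest)).
  apply/cvg_sup => -[tau /= [[addc oppc] It]] U Ux.
  exact: (finest_nbhs (conj addc oppc) It) (oppc x U Ux).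
Qed.

Lemma finest_ideal_null : is_ideal I -> ideal_null I u finest.
Proof.
move=> [[A0 IA0] Isub IU].
pose F : set_system G := [set U | I [set n | ~ U (u n)]].
have FF : Filter F.
  split.
  - by apply: Isub IA0 => n /=.
  - move=> P Q FP FQ; apply: Isub (IU _ _ FP FQ) => n /= /not_andP[]; tauto.
  - by move=> P Q PQ; apply: Isub => n /= nQ /PQ.
have : F --> ((0 : G) : top_space finest).
  by apply/cvg_sup => -[tau /= [gt It]] U /It.
exact.
Qed.

End finest_group_topology_theory.

(* Main.v *)
Require Import Defs.
From HB Require Import structures.
From mathcomp Require Import all_boot all_order all_algebra.
From mathcomp Require Import all_classical topology.

Local Open Scope classical_set_scope.
Local Open Scope ring_scope.

(**
The sets [tail_sums u J] satisfy the axioms of a base at 0 for a group topology: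
they are symmetric, and interleaving two sums shows that
[tail_sums u (fun i => J (2i+1))] added to itself lies in [tail_sums u J].  In
that topology u is I-null, so each [tail_sums u J] is a neighborhood of 0 in the
finest one.  Conversely, a neighborhood U of 0 in the finest topology contains a
chain [U = W 0, W 1, ...] with [W n.+1 + W n.+1 `<=` W n]; taking for [J n] the
indices k where [u k] or [- u k] leaves [W n.+1], the sums telescope into U.
*)

Import GRing.Theory.

(** The neighborhoods of [p] are taken to be the supersets of the translates [p + V]. The single
    condition on differences yields continuity of both addition and negation. *)
Lemma group_topology_of_base {G : zmodType} {B : set (set G)} :
  B !=set0 ->
  (forall V W, B V -> B W -> exists2 X, B X & X `<=` V `&` W) ->
  (forall V, B V -> V 0) ->
  (forall V, B V -> exists2 W, B W & forall x y, W x -> W y -> V (x - y)) ->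
  exists tau : Topological G, group_topology tau /\
    @nbhs_base (top_space tau) (0 : G) B.
Proof.
move=> [V0 BV0] BI B0 BB.
(* Write [x + y] as [x - (0 - y)] and apply the difference condition twice. *)
have BD V : B V -> exists2 W, B W & forall x y, W x -> W y -> V (x + y).
  move=> /BB[W BW WV]; have [X BX XW] := BB W BW.
  have [Y BY YWX] := BI _ _ BW BX.
  exists Y => // x y /YWX[Wx _] /YWX[_ Xy].
  rewrite -[y]opprK; apply: WV => //; rewrite -[- y]add0r.
  by apply: XW => //; exact: B0.
pose nb (p : G) : set (set G) := [set A | exists2 V, B V & forall z, V z -> A (p + z)].
have nbF p : ProperFilter (nb p).
  apply: Build_ProperFilter_ex.
    by move=> A [V BV VA]; exists (p + 0); apply: VA; exact: B0.
  split; first by exists V0.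
    move=> P Q [V BV VP] [W BW WQ]; have [X BX XVW] := BI _ _ BV BW.
    by exists X => // z /XVW[/VP ? /WQ ?].
  by move=> P Q PQ [V BV VP]; exists V => // z /VP /PQ.
have nb1 (p : G) A : nb p A -> A p.
  by move=> [V BV VA]; rewrite -[p]addr0; apply: VA; exact: B0.
(* When [W + W] lies in [V], [A] is a neighborhood of every point of [p + W]. *)
have nbnb (p : G) A : nb p A -> nb p (nb^~ A).
  move=> [V BV VA]; have [W BW WV] := BD V BV.
  exists W => // z Wz; exists W => // t Wt; rewrite -addrA.
  by apply: VA; exact: WV.
pose nbM := hasNbhs.Build G nb.
pose N : nbhsType := HB.pack G nbM.
pose T : topologicalType :=
  HB.pack G nbM (Nbhs_isNbhsTopological.Build N nbF nb1 nbnb).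
exists (Topological.class T); split; last first.
  split=> [U BU|U [V BV VU]]; first by exists U => // z; rewrite add0r.
  by exists V => // z /VU; rewrite add0r.
split=> [[x y] U [V BV VU]|x U [V BV VU]].
- have [W BW WV] := BD V BV.
  exists ([set x + z | z in W], [set y + z | z in W]).
    by split; exists W => // z Wz; exists z.
  move=> [_ _] [/= [a Wa <-] [b Wb <-]].
  by rewrite /= addrACA; apply: VU; exact: WV.
- have [W BW WV] := BB V BV.
  exists W => // z Wz; rewrite /= opprD; apply: VU; rewrite -[- z]add0r.
  by apply: WV => //; exact: B0.
Qed.

Lemma sum_nat_widen0 {G : zmodType} {x : nat -> G} {N M : nat} :
  (forall i, (N <= i)%N -> x i = 0) -> (N <= M)%N ->
  \sum_(0 <= i < M) x i = \sum_(0 <= i < N) x i.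
Proof.
move=> x0 NM; rewrite (big_cat_nat _ NM)//= [X in _ + X]big_nat_cond [X in _ + X]big1 ?addr0//.
by move=> i /andP[/andP[/x0]].
Qed.

Lemma sum_interleave {G : zmodType} (x y : nat -> G) N :
  \sum_(0 <= i < N.*2) (if odd i then y i./2 else x i./2) =
  \sum_(0 <= i < N) x i + \sum_(0 <= i < N) y i.
Proof.
elim: N => [|N IH]; first by rewrite !big_nil addr0.
rewrite doubleS !big_nat_recr//= IH odd_double/=.
by rewrite uphalf_double half_double -addrA addrACA.
Qed.

Section tail_sums_theory.
Context {G : zmodType} {u : nat -> G}.

Lemma sym_tail0 A : sym_tail u A 0.
Proof. by left; left. Qed.

Lemma sym_tailN A x : sym_tail u A x -> sym_tail u A (- x).
Proof.
move=> [[->|[n An <-]]|[n An <-]]; first by rewrite oppr0; exact: sym_tail0.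
  by right; exists n.
by rewrite opprK; left; right; exists n.
Qed.

Lemma sub_sym_tail A B : A `<=` B -> sym_tail u B `<=` sym_tail u A.
Proof.
move=> AB x [[->|[n Bn <-]]|[n Bn <-]]; first exact: sym_tail0.
  by left; right; exists n => // /AB.
by right; exists n => // /AB.
Qed.

(* The summands are indexed by all of nat and vanish from the N-th on, so that
   the length of the sum can be enlarged freely. *)
Lemma tail_sumsP J z :
  tail_sums u J z <->
  exists N (x : nat -> G),
    [/\ forall i, sym_tail u (J i) (x i), forall i, (N <= i)%N -> x i = 0 &
        z = \sum_(0 <= i < N) x i].
Proof.
split=> [[N _ [x xJ <-]]|[N [x [xJ x0 ->]]]].
  exists N.+1, (fun i => if (i < N.+1)%N then x (inord i) else 0); split.
  - move=> i; case: ifP => [iN|_]; last exact: sym_tail0.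
    by have := xJ (inord i); rewrite inordK.
  - by move=> i Ni; rewrite ltnNge Ni.
  - rewrite big_mkord; apply: eq_bigr => i _.
    by rewrite ltn_ord inord_val.
(* The sums in [tail_sums] have at least one term, so the sum is padded with [x N = 0]. *)
exists N => //; exists (fun i : 'I_N.+1 => x i); first by move=> i; exact: xJ.
by rewrite big_ord_recr /= x0// addr0 big_mkord.
Qed.

Lemma tail_sums0 J : tail_sums u J 0.
Proof.
apply/tail_sumsP; exists 0%N, (fun=> 0); split=> //; last by rewrite big_nil.
by move=> i; exact: sym_tail0.
Qed.

Lemma tail_sumsN J x : tail_sums u J x -> tail_sums u J (- x).
Proof.
move=> /tail_sumsP[N [y [yJ y0 ->]]]; apply/tail_sumsP; exists N, (fun i => - y i).
split=> [i|i /y0 ->|]; [exact: sym_tailN|exact: oppr0|by rewrite sumrN].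
Qed.

Lemma sub_tail_sums J K : (forall i, J i `<=` K i) ->
  tail_sums u K `<=` tail_sums u J.
Proof.
move=> JK z /tail_sumsP[N [x [xK x0 ->]]]; apply/tail_sumsP; exists N, x.
by split=> // i; exact: sub_sym_tail (xK i).
Qed.

Lemma sym_tail_sub_tail_sums J : sym_tail u (J 0%N) `<=` tail_sums u J.
Proof.
move=> z zJ; apply/tail_sumsP; exists 1%N, (fun i => if i is 0%N then z else 0).
by split=> [[|i]|[|i]|] //; [exact: sym_tail0|rewrite big_nat1].
Qed.

(** The i-th terms of the two sums go to positions 2i and 2i+1. Both avoid [J] at 2i+1, hence also
    the smaller [J] at 2i. *)
Lemma tail_sumsD J x y : (forall n, J n `<=` J n.+1) ->
  tail_sums u (fun i => J i.*2.+1) x -> tail_sums u (fun i => J i.*2.+1) y ->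
  tail_sums u J (x + y).
Proof.
move=> Jinc /tail_sumsP[N [a [aJ a0 ->]]] /tail_sumsP[M [b [bJ b0 ->]]].
rewrite -(sum_nat_widen0 a0 (leq_maxl N M)) -(sum_nat_widen0 b0 (leq_maxr N M)).
rewrite -sum_interleave; apply/tail_sumsP.
exists (maxn N M).*2, (fun i => if odd i then b i./2 else a i./2).
split=> // i.
  have := odd_double_half i; case: ifP => _ /= iE.
    by rewrite -{1}iE; exact: bJ.
  by rewrite -{1}iE add0n; apply: sub_sym_tail (aJ _); exact: Jinc.
rewrite -geq_half_double geq_max => /andP[Ni Mi].
by case: ifP => _; [exact: b0|exact: a0].
Qed.

End tail_sums_theory.

Lemma increasing_seq_leq {I : set (set nat)} {J : nat -> set nat} {m n : nat} :
  increasing_seq I J -> (m <= n)%N -> J m `<=` J n.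
Proof.
move=> [_ Jinc] /subnK <-; elim: (n - m)%N => [//|k IH].
by rewrite addSn; exact: subset_trans IH _.
Qed.

Lemma tail_sums_group_topology {G : zmodType} {I : set (set nat)} (u : nat -> G) :
  is_ideal I ->
  exists tau : Topological G, [/\ group_topology tau, ideal_null I u tau &
    forall J, increasing_seq I J ->
      @nbhs _ (top_space tau) (0 : G) (tail_sums u J)].
Proof.
move=> [[A IA] Isub IU].
have [|_ _ [J [IJ Jinc] <-] [K [IK Kinc] <-]|_ [J _ <-]|_ [J HJ <-]|tau [gt [nbT baseT]]] :=
  @group_topology_of_base G [set tail_sums u J | J in increasing_seq I].
- by exists (tail_sums u (fun=> A)); exists (fun=> A) => //; split=> // n k.
(* Larger index sets give smaller [tail_sums], so the pointwise union serves for the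
   intersection. *)
- exists (tail_sums u (fun n => J n `|` K n)).
    exists (fun n => J n `|` K n) => //; split=> n; first exact: IU.
    by move=> k [/Jinc|/Kinc]; [left|right].
  by move=> z zJK; split; move: z zJK; apply: sub_tail_sums => i k; [left|right].
- exact: tail_sums0.
- exists (tail_sums u (fun i => J i.*2.+1)).
    exists (fun i => J i.*2.+1) => //; split=> n; first exact: HJ.1.
    by apply: (increasing_seq_leq HJ); rewrite ltnS leq_double.
  by move=> x y xJ yJ; apply: tail_sumsD => //; [exact: HJ.2|exact: tail_sumsN].
exists tau; split=> // [U U0|J HJ]; last by apply: nbT; exists J.
have [_ [J [IJ _] <-] JU] := baseT U U0.
(* One-term sums already put [u n] in [U] for every [n] outside [J 0]. *)
apply: Isub (IJ 0%N) => n /= nU; apply: contrapT => nJ; apply/nU/JU.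
by apply: sym_tail_sub_tail_sums; left; right; exists n.
Qed.

(** Induction on the length, for all [k] at once: the first term and the sum of the others both lie
    in [W k.+1]. *)
Lemma chain_sum {G : zmodType} {W : nat -> set G} {x : nat -> G} :
  (forall n, W n 0) -> (forall n a b, W n.+1 a -> W n.+1 b -> W n (a + b)) ->
  (forall i, W i.+1 (x i)) -> forall N k, W k (\sum_(k <= i < k + N) x i).
Proof.
move=> W0 WD Wx; elim=> [|N IH] k; first by rewrite addn0 big_geq.
rewrite big_ltn ?addnS ?ltnS ?leq_addr// -addSn.
by apply: WD => //; exact: IH.
Qed.

Lemma group_topology_half {G : zmodType} {tau : Topological G} {U : set G} :
  group_topology tau -> @nbhs _ (top_space tau) (0 : G) U ->
  exists2 V, @nbhs _ (top_space tau) (0 : G) V &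
    forall x y, V x -> V y -> U (x + y).
Proof.
move=> [addc _] U0.
have [|[V W] /= [V0 W0] VWU] := addc ((0 : G), (0 : G)) U; first by rewrite /= addr0.
exists (V `&` W); first exact: (@filterI _ _ (@nbhs_filter (top_space tau) (0 : G))).
by move=> x y [Vx _] [_ Wy]; exact: (VWU (x, y)).
Qed.

Theorem proposition4p4 (G : zmodType) (I : set (set nat)) (u : nat -> G)
    (hI : is_free_ideal I) (hu : T_ideal_sequence I u) :
  @nbhs_base (top_space (finest_group_topology I u)) (0 : G)
    [set tail_sums u J | J in increasing_seq I].
Proof.
have [hid _] := hI; have [_ Isub IU] := hid.
set F := finest_group_topology I u.
have gF : group_topology F := finest_is_group_topology I u.
have nF : ideal_null I u F := finest_ideal_null hid.
split=> [_ [J HJ <-]|U U0].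
  have [tau [gt It nbT]] := tail_sums_group_topology u hid.
  by apply: (finest_nbhs gt It); exact: nbT.
pose nb V := @nbhs _ (top_space F) (0 : G) V.
have nb_mem V : nb V -> V 0 by exact: (@nbhs_singleton (top_space F)).
(* The condition [nb V] is moved under the existential so that choice gives a function on all sets,
   which can be iterated. *)
have half V : exists W, nb V -> nb W /\ forall x y, W x -> W y -> V (x + y).
  have [nV|nnV] := pselect (nb V); last by exists V => /nnV.
  by have [W ? ?] := group_topology_half gF nV; exists W.
have [f fP] := choice half.
pose W n := iter n f U.
have nW n : nb (W n) by elim: n => [//|n /fP[]].
have WD n x y : W n.+1 x -> W n.+1 y -> W n (x + y) by exact: (fP _ (nW n)).2.
have W0 n : W n 0 by exact: nb_mem.
have Wsub n x : W n.+1 x -> W n x.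
  by move=> Wx; rewrite -[x]addr0; exact: WD.
(* Both signs are excluded because [sym_tail] contains both; the shift to [n.+1] is the one that
   [chain_sum] asks for. *)
pose J n := [set k | ~ W n.+1 (u k)] `|` [set k | ~ W n.+1 (- u k)].
exists (tail_sums u J).
  exists J => //; split=> n.
    apply: IU; first exact: nF (nW n.+1).
    (* By continuity of negation, the second set of indices also comes from a neighborhood of 0. *)
    have : nb [set x | W n.+1 (- x)].
      by apply: (gF.2 (0 : G)); rewrite oppr0; exact: nW.
    exact: nF.
  by move=> k [] /= nWk; [left|right] => /Wsub.
move=> z /tail_sumsP[N [x [xJ _ ->]]]; apply: (@chain_sum G W x W0 WD _ N 0%N) => i.
have [[->//|[k /not_orP[/contrapT + _] <-]]|[k /not_orP[_ /contrapT] + <-]] := xJ i.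
  exact.
exact.
Qed.
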